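(* Let $F$ be an algebraically closed field of characteristic $p>0$ and let $G$ be a finite group. If $\operatorname{soc}(ZFG)$ is an ideal of $FG$, then $G=P\rtimes H$ with $P\in\operatorname{Syl}_p(G)$ and an abelian $p'$-group $H$.
   Context: $FG$ is the group algebra of $G$ over $F$, $ZFG$ its center, and $\operatorname{soc}(ZFG)$ the socle of the commutative finite-dimensional algebra $ZFG$ (sum of its minimal ideals; equivalently the annihilator in $ZFG$ of $J(ZFG)$). ''Ideal'' of $FG$ means two-sided ideal. $\operatorname{Syl}_p(G)$ is the set of Sylow $p$-subgroups; a $p'$-group is a finite group of order not divisible by $p$. *)

(* Defs.v *)
From mathcomp Require Import all_boot all_order all_algebra all_fingroup.
From mathcomp Require Import all_solvable all_field all_character.
From mathcomp Require Import boolp classical_sets.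

Set Implicit Arguments.
Unset Strict Implicit.
Unset Printing Implicit Defensive.

Import GRing.Theory.
Local Open Scope ring_scope.

Section Socle.

Variables (F : fieldType) (m n : nat).
Implicit Types (R : 'A[F]_(m, n)) (I J S T : 'A[F]_n).

(* [mx_ideal R I] only asks that [R * I] and [I * R] lie in [I];
   it does not require [I] to be contained in [R]. *)
Definition ideal_of R I : bool := (I <= R)%MS && mx_ideal R I.

Definition minimal_ideal R I : Prop :=
  [/\ ideal_of R I, I != 0
    & forall J, ideal_of R J -> (J < I)%MS -> J = 0].

(* There may be infinitely many minimal ideals, so their sum is described as
   the smallest subspace containing all of them. *)
Definition is_soc R S : Prop :=
  (forall I, minimal_ideal R I -> (I <= S)%MS) /\
  (forall T, (forall I, minimal_ideal R I -> (I <= T)%MS) -> (S <= T)%MS).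

(* The sum of the minimal ideals of a commutative algebra [R], as a matrix
   determined up to row space; the default [0] is never used, by [socP]. *)
Definition soc R : 'A[F]_n := xget 0 (is_soc R : set _).

Lemma is_soc_exists R : exists S, is_soc R S.
Proof.
pose lower S := forall T, (forall I, minimal_ideal R I -> (I <= T)%MS) ->
  (S <= T)%MS.
pose Q k := `[< exists2 S, lower S & \rank S = k >].
have Q0 : exists k, Q k.
  exists 0%N; apply/asboolP; exists 0; last by rewrite mxrank0.
  by move=> T _; apply: sub0mx.
have Qle k : Q k -> (k <= n ^ 2)%N.
  by move=> /asboolP[S _ <-]; apply: rank_leq_row.
case: (ex_maxnP Q0 Qle) => k /asboolP[S lowS rS] maxk.
exists S; split=> // I minI.
have lowSI : lower (S + I)%MS.
  by move=> T minT; rewrite addsmx_sub lowS // minT.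
have /maxk : Q (\rank (S + I)%MS) by apply/asboolP; exists (S + I)%MS.
rewrite -rS => leSI.
have /eqmxP eqS : (S == S + I)%MS.
  by rewrite -(geq_leqif (mxrank_leqif_eq (addsmxSl S I))).
by rewrite eqS addsmxSr.
Qed.

Lemma socP R : is_soc R (soc R).
Proof. exact: xgetPex (is_soc_exists R). Qed.

End Socle.

(* Main.v *)
Require Import Defs.
From mathcomp Require Import all_boot all_order all_algebra all_fingroup.
From mathcomp Require Import all_solvable all_field all_character.

Set Implicit Arguments.
Unset Strict Implicit.
Unset Printing Implicit Defensive.

Import GRing.Theory GroupScope.
Local Open Scope ring_scope.

(** Write [s] for the sum in FG of all p-elements of G, and call an element of
    FG nilpotent when it is so as a matrix of the regular representation.

    The key point is that [s] always lies in the socle of ZFG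
    ([p_elements_soc]).  For a nilpotent [a] in FG and q a large power of p,
    expand a^q and look at the coefficient of 1.  This is a sum over q-tuples of
    elements of G with product 1, and cyclic rotation of the tuples preserves
    the terms.  As q is a power of the characteristic, only constant tuples
    contribute, that is, the x with x^q = 1, which are the p-elements.  So the
    q-th power of the sum of the coefficients of [a] at p-elements vanishes
    ([sum_gring_coef_nilp]).  Apply this to the translates of a central
    nilpotent [z]: up to inversion of p-elements, these sums are the
    coefficients of [z s], so [z s = 0] ([p_elements_mul_nilp]).  On the
    other hand, in a commutative algebra over a closed field, an element killed
    by all nilpotents is a sum of common eigenvectors, each of which spans a
    minimal ideal ([annihilator_nilp_sub_soc]).

    Now let [I] be an ideal of FG contained in ZFG.  For [t] in [I], both [t]
    and [t x] are central, so [t x y = y t x = t y x]; thus [t] absorbs all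
    commutators, hence all of G' ([der1_rstab_center_ideal]).  Applied to [s]
    and the socle, [s c = s] for all [c] in G'.  The coefficient of 1 in [s] is
    1, and in [s c] it is the coefficient of c^-1 in [s], so [c] is a p-element.
    Thus G' is a p-group ([der1_pgroup]); it is then contained in a Sylow
    p-subgroup P, which is normal with abelian quotient, and Schur-Zassenhaus
    provides the complement ([sdprod_der1_pgroup]). *)

(** * Sums invariant under a p-group, in characteristic p *)

(** The weighted form of the congruence between the size of a set and the
    number of its fixed points: a nontrivial orbit has size divisible by p. *)
Lemma sum_pgroup_fix (R : nzRingType) (p : nat) (aT : finGroupType)
    (sT : finType) (to : {action aT &-> sT}) (A : {group aT}) (w : sT -> R) :
    p \in [pchar R] -> p.-group A ->
    (forall x a, a \in A -> w (to x a) = w x) ->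
  \sum_x w x = \sum_(x in 'Fix_to(A)) w x.
Proof.
move=> charRp pA wA.
rewrite (bigID (mem 'Fix_to(A))) /= [X in _ + X](_ : _ = 0) ?addr0 //.
have actsD : [acts A, on ~: 'Fix_to(A) | to].
  by rewrite astabsC acts_fix_norm ?normG.
rewrite (eq_bigl (mem (~: 'Fix_to(A)))) => [|x]; last by rewrite !inE.
rewrite (set_partition_big _ (orbit_partition actsD)) big1 // => X.
case/imsetP=> x; rewrite inE => nFx ->.
rewrite (eq_bigr (fun _ => w x)) => [|_ /orbitP[a Aa <-]]; last exact: wA.
suffices /dvdnP[k eqk] : (p %| #|orbit to A x|)%N.
  by rewrite sumr_const eqk -mulr_natr natrM (pcharf0 charRp) !mulr0.
have/(pgroup_fix_mod pA) := acts_orbit to x (subsetT A).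
rewrite /dvdn => ->; rewrite [_ :&: _](_ : _ = set0) ?cards0 ?mod0n //.
apply/setP=> y; rewrite in_setI in_set0; apply: contraNF nFx => /andP[xAy Fy].
suffices <- : y = x by [].
move: xAy; rewrite orbit_sym => /orbitP[a Aa <-].
by rewrite (afixP Fy).
Qed.

Lemma val_iter_ordS n k (i : 'I_n) :
  iter k (@ordS n) i = ((i + k) %% n)%N :> nat.
Proof.
elim: k => [|k IHk]; first by rewrite addn0 modn_small.
by rewrite iterS /= IHk -addn1 modnDml -addnA addn1.
Qed.

(** The rotation of tuples of length [p ^ m] generates a p-group, and its fixed
    points are the constant tuples. *)
Lemma sum_ffun_rot (R : nzRingType) (p m : nat) (T : finType)
    (w : {ffun 'I_(p ^ m) -> T} -> R) :
    p \in [pchar R] ->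
    (forall f : {ffun 'I_(p ^ m) -> T}, w [ffun i => f (ordS i)] = w f) ->
  \sum_f w f = \sum_(t : T) w [ffun => t].
Proof.
move=> charRp w_rot; set q := (p ^ m)%N in w w_rot *.
have p_pr := pcharf_prime charRp.
have q_gt0 : (0 < q)%N by rewrite expn_gt0 prime_gt0.
pose rotf (f : {ffun 'I_q -> T}) := [ffun i => f (ordS i)].
have rotI : injective rotf.
  move=> f g /ffunP eq_fg; apply/ffunP=> i; rewrite -[i]ord_predK.
  by have := eq_fg (ord_pred i); rewrite !ffunE.
pose s := perm rotI.
have rot_iter k f i : (s ^+ k)%g f i = f (iter k (@ordS q) i).
  elim: k f i => [|k IHk] f i; first by rewrite perm1.
  by rewrite expgSr permM permE ffunE IHk -iterSr.
have sq1 : (s ^+ q = 1)%g.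
  apply/permP=> f; rewrite perm1; apply/ffunP=> i; rewrite rot_iter.
  by congr (f _); apply/val_inj; rewrite [LHS]val_iter_ordS modnDr modn_small.
have p_s : p.-group <[s]>.
  have qP : p.-nat q by rewrite pnatX pnat_id.
  by apply: pnat_dvd qP; rewrite order_dvdn sq1.
rewrite (sum_pgroup_fix (to := perm_action _) (w := w) charRp p_s) ?afix_cycle;
  last first.
  move=> f _ /cycleP[k ->]; elim: k => [|k IHk]; first by rewrite act1.
  by rewrite expgSr actM -[RHS]IHk /= apermE permE w_rot.
pose i0 := Ordinal q_gt0.
rewrite (reindex_onto (fun t => [ffun => t]) (fun f : {ffun _} => f i0)) /=.
  apply: eq_bigl => t; rewrite ffunE eqxx andbT.
  apply/afix1P; rewrite /= apermE permE; apply/ffunP=> i.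
  by rewrite !ffunE.
move=> f /afix1P fix_f; apply/ffunP=> i; rewrite ffunE.
have fixk k : (s ^+ k)%g f = f.
  elim: k => [|k IHk]; first by rewrite perm1.
  by rewrite expgSr permM IHk; apply: fix_f.
(* Rotating [q - i] times brings the entry at [0] to position [i]. *)
rewrite -[in RHS](fixk (q - i)%N) rot_iter; congr (f _); apply/val_inj.
by rewrite [RHS]val_iter_ordS subnKC ?modnn // ltnW.
Qed.

(** * Coefficients in the group ring *)

Section Coefficients.

Variables (F : fieldType) (gT : finGroupType) (G : {group gT}).
Local Notation aG := (regular_repr F G).
Local Notation FG := (group_ring F G).
Implicit Types A B : 'M[F]_#|G|.

Definition gring_coef (x : gT) A : F := gring_proj (G := G) x A 0 0.

Lemma gring_coef_sum I (r : seq I) (P : pred I) (E : I -> 'M_#|G|) x :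
  gring_coef x (\sum_(i <- r | P i) E i) =
  \sum_(i <- r | P i) gring_coef x (E i).
Proof. by rewrite /gring_coef linear_sum summxE. Qed.

Lemma gring_coefZ x c A : gring_coef x (c *: A) = c * gring_coef x A.
Proof. by rewrite /gring_coef linearZ mxE. Qed.

Lemma gring_coef0 x : gring_coef x 0 = 0.
Proof. by rewrite /gring_coef linear0 mxE. Qed.

Lemma gring_coef_repr x y :
  x \in G -> y \in G -> gring_coef x (aG y) = (x == y)%:R.
Proof.
move=> Gx Gy; rewrite /gring_coef gring_projE //.
by case: (x == y); rewrite mxE.
Qed.

Lemma gring_coef_gset x (D : {set gT}) :
  x \in G -> D \subset G -> gring_coef x (gset_mx F G D) = (x \in D)%:R.
Proof.
move=> Gx /subsetP sDG; rewrite gring_coef_sum.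
have [Dx | D'x] := boolP (x \in D).
  rewrite (bigD1 x) //= gring_coef_repr // eqxx big1 ?addr0 // => y.
  by case/andP=> /sDG Gy ne_yx; rewrite gring_coef_repr // eq_sym (negPf ne_yx).
rewrite big1 // => y Dy; rewrite gring_coef_repr //; last exact: sDG.
by case: eqP D'x => // ->; rewrite Dy.
Qed.

Lemma gring_expand A :
  (A \in FG)%MS -> A = \sum_(x in G) gring_coef x A *: aG x.
Proof.
case/envelop_mxP=> a ->; apply: eq_bigr => x Gx; congr (_ *: _).
rewrite gring_coef_sum (bigD1 x) //= gring_coefZ gring_coef_repr // eqxx mulr1.
rewrite big1 ?addr0 // => y /andP[Gy ne_yx].
by rewrite gring_coefZ gring_coef_repr // eq_sym (negPf ne_yx) mulr0.
Qed.

Lemma eq_gring_coef A B : (A \in FG)%MS -> (B \in FG)%MS ->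
  {in G, forall x, gring_coef x A = gring_coef x B} -> A = B.
Proof.
move=> FA FB eqAB; rewrite (gring_expand FA) (gring_expand FB).
by apply: eq_bigr => x Gx; rewrite eqAB.
Qed.

Lemma gring_coefMl x y A : x \in G -> y \in G -> (A \in FG)%MS ->
  gring_coef x (aG y *m A) = gring_coef (y^-1 * x)%g A.
Proof.
move=> Gx Gy FA; rewrite [in LHS](gring_expand FA) [in RHS](gring_expand FA).
rewrite mulmx_sumr !gring_coef_sum; apply: eq_bigr => z Gz.
rewrite -scalemxAr !gring_coefZ -repr_mxM //.
rewrite !gring_coef_repr ?groupM ?groupV //.
by rewrite -(inj_eq (mulgI y^-1%g)) mulKg.
Qed.

Lemma gring_coefMr x y A : x \in G -> y \in G -> (A \in FG)%MS ->
  gring_coef x (A *m aG y) = gring_coef (x * y^-1)%g A.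
Proof.
move=> Gx Gy FA; rewrite [in LHS](gring_expand FA) [in RHS](gring_expand FA).
rewrite mulmx_suml !gring_coef_sum; apply: eq_bigr => z Gz.
rewrite -scalemxAl !gring_coefZ -repr_mxM //.
rewrite !gring_coef_repr ?groupM ?groupV //.
by rewrite -(inj_eq (mulIg y^-1%g)) mulgK.
Qed.

(** The coefficient of 1 is a trace form on FG, as [x y = 1] iff [y x = 1]. *)
Lemma gring_coef1C A B : (A \in FG)%MS -> (B \in FG)%MS ->
  gring_coef 1 (A *m B) = gring_coef 1 (B *m A).
Proof.
move=> FA FB; rewrite (gring_expand FA) mulmx_suml mulmx_sumr !gring_coef_sum.
apply: eq_bigr => x Gx; rewrite -scalemxAl -scalemxAr !gring_coefZ.
by rewrite gring_coefMl // gring_coefMr // mulg1 mul1g.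
Qed.

Lemma gset_mx_in (D : {set gT}) : D \subset G -> (gset_mx F G D \in FG)%MS.
Proof.
move=> /subsetP sDG; rewrite /gset_mx linear_sum summx_sub //= => x Dx.
by rewrite envelop_mx_id ?sDG.
Qed.

Lemma group_ring1 : (1%:M \in FG)%MS.
Proof. by rewrite -(repr_mx1 aG) envelop_mx_id. Qed.

Lemma gring_coef1_rot n (h : 'I_n -> 'M[F]_#|G|) :
    (forall i, (h i \in FG)%MS) ->
  gring_coef 1 (\prod_i h (ordS i)) = gring_coef 1 (\prod_i h i).
Proof.
case: n h => [|n] h Fh; first by rewrite !big_ord0.
have Fprod (f : 'I_n -> 'I_n.+1) : (\prod_i h (f i) \in FG)%MS.
  by elim/big_ind: _ => // [|B C]; [apply: group_ring1 | apply: envelop_mxM].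
rewrite big_ord_recr big_ord_recl /= [LHS]gring_coef1C //.
(* The last factor on the left is the first one on the right: [n.+1] wraps
   around to [0]. *)
congr (gring_coef _ (h _ *m _)); first by apply: val_inj; rewrite /= modnn.
apply: eq_bigr => i _; congr (h _); apply: val_inj.
by rewrite /= modn_small ?ltnS.
Qed.

End Coefficients.

(** * The sum of the p-elements annihilates central nilpotents *)

Section PElements.

Variables (F : fieldType) (p : nat) (gT : finGroupType) (G : {group gT}).
Hypothesis charFp : p \in [pchar F].
Local Notation aG := (regular_repr F G).
Local Notation FG := (group_ring F G).

(** Frobenius for a noncommutative ring, seen through a trace form: expanding
    the power over tuples of group elements, all but the constant tuples cancel
    in rotation orbits. *)
Lemma gring_coef1_pexp m A : (A \in FG)%MS ->
  gring_coef 1 (A ^+ (p ^ m)) =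
  \sum_(x in G | (x ^+ (p ^ m) == 1)%g) gring_coef x A ^+ (p ^ m).
Proof.
move=> FA; set q := (p ^ m)%N.
(* Extended by zero outside [G], so that the tuples range over all of [gT]. *)
pose h x : 'M[F]_#|G| := if x \in G then gring_coef x A *: aG x else 0.
have Fh x : (h x \in FG)%MS.
  rewrite /h; case: ifP => Gx; last by rewrite linear0 sub0mx.
  by rewrite linearZ scalemx_sub ?envelop_mx_id.
pose w (f : {ffun 'I_q -> gT}) := gring_coef 1 (\prod_i h (f i)).
have -> : gring_coef 1 (A ^+ q) = \sum_f w f.
  have -> : A ^+ q = \prod_(i < q) \sum_x h x.
    by rewrite prodr_const card_ord /h -big_mkcond -gring_expand.
  by rewrite bigA_distr_bigA gring_coef_sum.
rewrite (sum_ffun_rot (w := w) charFp) => [|f]; last first.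
  rewrite /w; under eq_bigr do rewrite ffunE.
  by rewrite (gring_coef1_rot (h := fun i => h (f i))).
rewrite big_mkcondr [RHS]big_mkcond; apply: eq_bigr => x _.
rewrite /w; under eq_bigr do rewrite ffunE.
rewrite prodr_const card_ord /h; case: ifP => Gx; last first.
  rewrite expr0n; case: eqP => [/eqP|_]; last by rewrite gring_coef0.
  by rewrite expn_eq0 -leqn0 leqNgt prime_gt0 // (pcharf_prime charFp).
have -> : (gring_coef x A *: aG x) ^+ q = gring_coef x A ^+ q *: aG (x ^+ q)%g.
  elim: q {w} => [|k IHk]; first by rewrite !expr0 expg0 repr_mx1 scale1r.
  rewrite !exprS expgS repr_mxM ?groupX // IHk -[LHS]scalemxAl -scalemxAr.
  by rewrite scalerA.
rewrite gring_coefZ gring_coef_repr ?groupX // eq_sym.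
by case: eqP => _; rewrite ?mulr1 ?mulr0.
Qed.

(** With [q] a power of p that exceeds both the nilpotency index and the order
    of G, the solutions of [x ^+ q = 1] are the p-elements, and the sum over
    them of the q-th powers of the coefficients is the q-th power of their
    sum. *)
Lemma sum_gring_coef_nilp k A : (A \in FG)%MS -> A ^+ k = 0 ->
  \sum_(x in G | p.-elt x) gring_coef x A = 0.
Proof.
move=> FA Ak0; have p_pr := pcharf_prime charFp.
have p_gt1 := prime_gt1 p_pr.
pose m := maxn k #|G|; set q := (p ^ m)%N.
have le_kq : (k <= q)%N.
  by apply: leq_trans (leq_maxl k #|G|) (ltnW (ltn_expl m p_gt1)).
have pelt_q x : x \in G -> p.-elt x = (x ^+ q == 1)%g.
  move=> Gx; rewrite -order_dvdn; apply/idP/idP => [px | xq].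
    have [j ox] := p_natP px; rewrite ox dvdn_exp2l //.
    rewrite -(leq_exp2l _ _ p_gt1) -ox.
    apply: leq_trans (dvdn_leq (cardG_gt0 G) (order_dvdG Gx)) _.
    exact: leq_trans (leq_maxr k #|G|) (ltnW (ltn_expl m p_gt1)).
  by apply: pnat_dvd xq _; rewrite pnatX pnat_id.
rewrite (eq_bigl (fun x => (x \in G) && (x ^+ q == 1)%g)); last first.
  by move=> x; case Gx: (x \in G); rewrite //= pelt_q.
apply/eqP; suffices: (\sum_(x in G | (x ^+ q == 1)%g) gring_coef x A) ^+ q == 0.
  by rewrite expf_eq0 => /andP[].
have charq : [pchar F].-nat q by rewrite pnatX pnatE // charFp.
have Fq0 : 0 ^+ q = 0 :> F by rewrite expr0n expn_eq0 eqn0Ngt ltnW.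
rewrite (big_morph (fun y : F => y ^+ q)
  (fun x y => exprDn_pchar x y charq) Fq0).
have Aq0 : A ^+ q = 0 by rewrite -(subnKC le_kq) exprD Ak0 mul0r.
by rewrite -gring_coef1_pexp // Aq0 gring_coef0.
Qed.

Definition p_elements := [set x in G | p.-elt x].

Lemma p_elements_sub : p_elements \subset G.
Proof. by apply/subsetP=> x; rewrite inE => /andP[]. Qed.

Lemma p_elements_center : (gset_mx F G p_elements \in 'Z(FG))%MS.
Proof.
have Fs : (gset_mx F G p_elements \in FG)%MS.
  by rewrite gset_mx_in ?p_elements_sub.
apply/center_mxP; split=> // A /envelop_mxP[a ->].
rewrite mulmx_suml mulmx_sumr; apply: eq_bigr => x Gx.
rewrite -scalemxAl -scalemxAr; congr (_ *: _).
apply: eq_gring_coef => [||y Gy]; try by rewrite envelop_mxM ?envelop_mx_id.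
rewrite gring_coefMl // gring_coefMr // !gring_coef_gset ?groupM ?groupV //;
  try exact: p_elements_sub.
rewrite !inE !groupM ?groupV // -(p_eltJ p (x^-1 * y) x^-1).
by rewrite conjgE invgK -mulgA mulKVg.
Qed.

(** The coefficient of [x] in [z *m s] is the coefficient of 1 in
    [aG x^-1 *m z *m s], which sums the coefficients of the nilpotent
    [aG x^-1 *m z] over the inverses of the p-elements. *)
Lemma p_elements_mul_nilp z k :
  (z \in 'Z(FG))%MS -> z ^+ k = 0 -> gset_mx F G p_elements *m z = 0.
Proof.
case/center_mxP=> Fz Zz zk0; set s := gset_mx F G p_elements.
have Fs : (s \in FG)%MS by rewrite gset_mx_in ?p_elements_sub.
rewrite Zz //; apply: eq_gring_coef; rewrite ?linear0 ?sub0mx ?envelop_mxM //.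
move=> x Gx; rewrite gring_coef0.
have Gx' : x^-1%g \in G by rewrite groupV.
have Fx := envelop_mx_id aG Gx'; set A := aG x^-1%g *m z.
have FA : (A \in FG)%MS by rewrite envelop_mxM.
have Ak0 : A ^+ k = 0.
  suffices -> : A ^+ k = aG x^-1%g ^+ k *m z ^+ k by rewrite zk0 mulmx0.
  by apply: exprMn_comm; apply: (Zz _ Fx).
have -> : gring_coef x (z *m s) = gring_coef 1 (A *m s).
  by rewrite -mulmxA gring_coefMl ?envelop_mxM ?invgK ?mulg1.
rewrite mulmx_sumr gring_coef_sum -[RHS](sum_gring_coef_nilp FA Ak0).
rewrite (reindex_inj invg_inj) /=; apply: eq_big => y.
  by rewrite inE groupV p_eltV.
rewrite inE groupV p_eltV => /andP[Gy _].
by rewrite gring_coefMr ?groupV // invgK mul1g.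
Qed.

End PElements.

(** * Semisimple elements of a commutative matrix algebra *)

(** The usual decomposition into eigenvectors along a squarefree split
    polynomial that kills [v], by coprimality of one linear factor with the
    product of the others.  The components are multiples of [v] by polynomials
    in [z], so they inherit every property [S] stable under such multiples; this
    is what lets decompositions for several commuting matrices be combined. *)
Lemma eigen_span (F : fieldType) n m (z : 'M[F]_n.+1) (T : 'A[F]_(m, n.+1))
    (S : 'M[F]_n.+1 -> Prop) (rs : seq F) v :
    (forall q u, S u -> S (u *m horner_mx z q)) ->
    (forall a u, S u -> u *m z = a *: u -> (u \in T)%MS) ->
    uniq rs -> S v -> v *m horner_mx z (\prod_(a <- rs) ('X - a%:P)) = 0 ->
  (v \in T)%MS.
Proof.
have hornerM f g : horner_mx z (f * g) = horner_mx z f *m horner_mx z g.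
  exact: rmorphM.
move=> Shorner Seigen; elim: rs v => [|a rs IHrs] v /=.
  by rewrite big_nil rmorph1 mulmx1 => _ Sv ->; rewrite linear0 sub0mx.
case/andP=> rs'a uniq_rs Sv; rewrite big_cons; set g := \prod_(_ <- _) _ => fz0.
have /Bezout_eq1_coprimepP[[b c] /= bezout] : coprimep g ('X - a%:P).
  by rewrite coprimep_XsubC root_prod_XsubC.
have -> : v = v *m horner_mx z (b * g) + v *m horner_mx z (c * ('X - a%:P)).
  by rewrite -mulmxDr -rmorphD bezout rmorph1 mulmx1.
rewrite linearD addmx_sub //.
  apply: (Seigen a); first exact: Shorner.
  apply/eqP; rewrite -subr_eq0; apply/eqP; rewrite -mul_mx_scalar -mulmxBr.
  have -> : z - a%:M = horner_mx z ('X - a%:P).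
    by rewrite rmorphB /= horner_mx_X horner_mx_C.
  by rewrite -mulmxA -hornerM mulrC mulrCA mulrC hornerM mulmxA fz0 mul0mx.
apply: IHrs => //; first exact: Shorner.
by rewrite -mulmxA -hornerM -mulrA mulrC hornerM mulmxA fz0 mul0mx.
Qed.

Lemma horner_mx_subring (F : fieldType) m n (R : 'A[F]_(m, n.+1)) z f :
  (1%:M \in R)%MS -> (R * R <= R)%MS -> (z \in R)%MS ->
  (horner_mx z f \in R)%MS.
Proof.
move=> R1 RM Rz; elim/poly_ind: f => [|f c IHf].
  by rewrite rmorph0 linear0 sub0mx.
rewrite rmorphD rmorphM /= horner_mx_X horner_mx_C linearD addmx_sub //.
  by apply: (mulsmx_subP RM).
by rewrite -scalemx1 linearZ scalemx_sub.
Qed.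

(** Over a closed field, the radical of the characteristic polynomial: some
    power of it is a multiple of that polynomial, so Cayley-Hamilton makes its
    value at [z] nilpotent. *)
Lemma squarefree_annihilator (F : closedFieldType) n (z : 'M[F]_n.+1) :
  exists rs : seq F, exists k, uniq rs /\
    horner_mx z (\prod_(a <- rs) ('X - a%:P)) ^+ k = 0.
Proof.
have [rs def_chi] := closed_field_poly_normal (char_poly z).
exists (undup rs), (size rs); rewrite undup_uniq -rmorphXn; split=> //=.
set f := \prod_(_ <- _) _.
have dvd_f (s : seq F) : {subset s <= rs} ->
    \prod_(a <- s) ('X - a%:P) %| f ^+ size s.
  elim: s => [|a s IHs] sub_s; first by rewrite big_nil expr0.
  rewrite big_cons exprS dvdp_mul ?IHs // => [|b s_b].
    by rewrite dvdp_XsubCl root_prod_XsubC mem_undup sub_s ?mem_head.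
  by rewrite sub_s // inE s_b orbT.
have: char_poly z %| f ^+ size rs.
  by rewrite def_chi (monicP (char_poly_monic z)) scale1r dvd_f.
by case/dvdpP=> q ->; rewrite rmorphM /= Cayley_Hamilton mulr0.
Qed.

(** A common eigenvector spans a one-dimensional ideal, which is minimal for
    reasons of dimension. *)
Lemma eigen_line_sub_soc (F : fieldType) (m n : nat) (R : 'A[F]_(m, n)) v :
    (forall A B, (A \in R)%MS -> (B \in R)%MS -> A *m B = B *m A) ->
    (v \in R)%MS ->
    (forall z, (z \in R)%MS -> exists a, v *m z = a *: v) ->
  (v \in soc R)%MS.
Proof.
move=> Rcomm Rv eig_v; have [-> | nz_v] := eqVneq v 0.
  by rewrite linear0 sub0mx.
have lineP A : (A \in <<mxvec v>>)%MS -> exists a, A = a *: v.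
  rewrite genmxE => /sub_rVP[a Aav]; exists a.
  by apply: (can_inj mxvecK); rewrite Aav linearZ.
have line_a a : (a *: v \in <<mxvec v>>)%MS.
  by rewrite genmxE linearZ scalemx_sub.
rewrite -(genmxE (mxvec v)); apply: (socP R).1; split.
- apply/andP; split; first by rewrite genmxE.
  apply/andP; split; apply/mulsmx_subP=> A B.
    move=> RA /lineP[b ->]; rewrite -scalemxAr (Rcomm A) //.
    by have [a ->] := eig_v _ RA; rewrite scalerA line_a.
  move=> /lineP[b ->] RB; rewrite -scalemxAl.
  by have [a ->] := eig_v _ RB; rewrite scalerA line_a.
- by rewrite -mxrank_eq0 genmxE mxrank_eq0 (can2_eq mxvecK vec_mxK) linear0.
move=> J _; rewrite ltmxErank => /andP[_ ltJ]; apply/eqP.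
rewrite -mxrank_eq0 -leqn0 -ltnS.
by apply: leq_trans ltJ _; rewrite genmxE rank_leq_row.
Qed.

(** The spanning matrices [Z i] of [R] act on the annihilator of the nilpotents
    as commuting diagonalisable maps: the squarefree polynomial of [Z i] has a
    nilpotent value, which acts as zero.  Splitting along one [Z i] after
    another decomposes [s] into common eigenvectors. *)
Lemma annihilator_nilp_sub_soc (F : closedFieldType) (m n : nat)
    (R : 'A[F]_(m, n)) (s : 'M[F]_n) :
    (1%:M \in R)%MS -> (R * R <= R)%MS ->
    (forall A B, (A \in R)%MS -> (B \in R)%MS -> A *m B = B *m A) ->
    (s \in R)%MS ->
    (forall z k, (z \in R)%MS -> z ^+ k = 0 -> s *m z = 0) ->
  (s \in soc R)%MS.
Proof.
case: n R s => [|n] R s R1 RM Rcomm Rs nilp_s.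
  by rewrite [s]flatmx0 linear0 sub0mx.
have Rmul A B : (A \in R)%MS -> (B \in R)%MS -> (A *m B \in R)%MS.
  exact: (mulsmx_subP RM).
pose ann v := (v \in R)%MS /\
  forall z k, (z \in R)%MS -> z ^+ k = 0 -> v *m z = 0.
pose Z i := vec_mx (row i R).
have RZ i : (Z i \in R)%MS by rewrite /Z vec_mxK row_sub.
pose eig (v z : 'M[F]_n.+1) := exists a : F, v *m z = a *: v.
(* [l] lists the [Z i] along which [v] is still to be split. *)
suffices split_eig (l : seq 'I_m) v : ann v ->
  (forall i, i \notin l -> eig v (Z i)) -> (v \in soc R)%MS.
  apply: (split_eig (enum 'I_m)); first by split.
  by move=> i; rewrite mem_enum.
elim: l v => [|j l IHl] v [Rv nilp_v] eig_v.
  apply: eigen_line_sub_soc => // z /submxP[c /(canRL mxvecK) ->].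
  have [a vZ] := fin_all_exists (fun i => eig_v i isT).
  exists (\sum_i c 0 i * a i); rewrite mulmx_sum_row linear_sum mulmx_sumr.
  rewrite scaler_suml; apply: eq_bigr => i _.
  by rewrite linearZ -scalemxAr [_ *m _]vZ scalerA.
have [rs [k [uniq_rs nilp_f]]] := squarefree_annihilator (Z j).
pose S v := ann v /\ forall i, i \notin j :: l -> eig v (Z i).
have Rhorner f : (horner_mx (Z j) f \in R)%MS by apply: horner_mx_subring.
apply: (@eigen_span _ _ _ (Z j) _ S rs) => //; last exact: (nilp_v _ k).
  move=> f u [[Ru nilp_u] eig_u]; set y := horner_mx _ f.
  have Ry : (y \in R)%MS := Rhorner f.
  split; first split; first exact: Rmul.
    move=> z i Rz zi0; rewrite -mulmxA (Rcomm y) // mulmxA (nilp_u _ i) //.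
    by rewrite mul0mx.
  move=> i /eig_u[a uZ]; exists a.
  by rewrite -mulmxA (Rcomm y) // mulmxA uZ scalemxAl.
move=> a u [ann_u eig_u] uZj; apply: IHl => // i l'i.
have [-> | ne_ij] := eqVneq i j; first by exists a.
by apply: eig_u; rewrite inE negb_or ne_ij.
Qed.

Lemma soc_sub (F : fieldType) m n (R : 'A[F]_(m, n)) : (soc R <= R)%MS.
Proof.
rewrite -(genmxE R); apply: (socP R).2 => I [/andP[sIR _] _ _].
by rewrite genmxE.
Qed.

(** * Ideals inside the center and the derived subgroup *)

Section Conclusion.

Variables (F : closedFieldType) (p : nat) (gT : finGroupType) (G : {group gT}).
Hypothesis charFp : p \in [pchar F].
Local Notation aG := (regular_repr F G).
Local Notation FG := (group_ring F G).

(** The center of FG is a commutative algebra over a closed field, and the sum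
    of the p-elements annihilates its nilpotents. *)
Lemma p_elements_soc : (gset_mx F G (p_elements p G) \in soc 'Z(FG))%MS.
Proof.
apply: annihilator_nilp_sub_soc.
- by apply/center_mxP; split=> [|A _]; rewrite ?group_ring1 ?mulmx1 ?mul1mx.
- apply/mulsmx_subP=> A B /center_mxP[FA ZA] /center_mxP[FB ZB].
  apply/center_mxP; split=> [|C FC]; first exact: envelop_mxM.
  by rewrite mulmxA ZA // -!mulmxA ZB.
- by move=> A B /center_mxP[FA _] /center_mxP[_ ZB]; apply: ZB.
- exact: p_elements_center.
by move=> z k; apply: p_elements_mul_nilp.
Qed.

(** An element [s] of such an ideal is central and so is [s x], so that
    [s x y = y s x = s y x]. *)
Lemma der1_rstab_center_ideal (I : 'A[F]_#|G|) s :
    ideal_of FG I -> (I <= 'Z(FG))%MS -> (s \in I)%MS ->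
  G^`(1)%g \subset rstab aG s.
Proof.
case/andP=> _ /andP[_ /mulsmx_subP IM] sIZ Is.
have Fg x : x \in G -> (aG x \in FG)%MS by apply: envelop_mx_id.
have sC x y : x \in G -> y \in G -> s *m aG (x * y)%g = s *m aG (y * x)%g.
  move=> Gx Gy; have Isx := IM _ _ Is (Fg x Gx).
  have [_ Zsx] := center_mxP (submx_trans Isx sIZ).
  have [_ Zs] := center_mxP (submx_trans Is sIZ).
  by rewrite !repr_mxM // mulmxA -Zsx ?Fg // mulmxA Zs ?Fg // mulmxA.
rewrite gen_subG; apply/subsetP=> _ /imset2P[x y Gx Gy ->].
rewrite inE groupR //; apply/eqP.
have -> : [~ x, y] = (x^-1 * y^-1 * (y^-1 * x^-1)^-1)%g.
  by rewrite invMg !invgK /commg conjgE !mulgA.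
have [Gx' Gy'] : x^-1%g \in G /\ y^-1%g \in G by rewrite !groupV.
have Gu : (y^-1 * x^-1)%g \in G by rewrite groupM.
rewrite repr_mxM ?groupM ?(groupVr Gu) // mulmxA sC // -mulmxA.
by rewrite -repr_mxM ?(groupVr Gu) // mulgV repr_mx1 mulmx1.
Qed.

(** By Cauchy it suffices to see that each [c] in G' is a p-element; this
    results from comparing the coefficients of 1 in [s *m aG c = s]. *)
Lemma der1_pgroup :
  ideal_of FG (soc 'Z(FG)%MS) -> p.-group G^`(1)%g.
Proof.
move=> idS; set s := gset_mx F G (p_elements p G).
have Fs : (s \in FG)%MS by rewrite gset_mx_in ?p_elements_sub.
have sub_stab := der1_rstab_center_ideal idS (soc_sub _) p_elements_soc.
have pelt_der c : c \in G^`(1)%g -> p.-elt c.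
  move=> G'c; have Gc := subsetP (der_sub 1 G) c G'c.
  have/subsetP/(_ c G'c) := sub_stab; rewrite inE Gc.
  move/eqP/(congr1 (gring_coef 1)).
  rewrite gring_coefMr // mul1g !gring_coef_gset ?groupV ?p_elements_sub //.
  rewrite !inE group1 p_elt1 groupV Gc p_eltV /=.
  by case: (p.-elt c) => // /eqP; rewrite eq_sym oner_eq0.
apply/pgroupP=> q q_pr /(Cauchy q_pr)[x G'x oq].
by have := pelt_der x G'x; rewrite /p_elt oq pnatE.
Qed.

End Conclusion.

Lemma sdprod_der1_pgroup (p : nat) (gT : finGroupType) (G : {group gT}) :
    p.-group G^`(1)%g ->
  exists P H : {group gT},
    [/\ P \in 'Syl_p(G)%g, (P ><| H = G)%g, abelian H & (p^'.-group H)%g].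
Proof.
move=> pG'; have [P sylP] := Sylow_exists p G.
have [sPG pP p'iP] := and3P sylP.
have sG'P : G^`(1)%g \subset P.
  apply: subset_trans (pcore_sub_Hall sylP).
  by rewrite pcore_max ?der_normal.
have nPG := sub_der1_normal sG'P sPG.
have /splitsP[H /complP[tiPH defG]] :=
  SchurZassenhaus_split (pHall_Hall sylP) nPG.
have sHG : H \subset G by rewrite -defG mulG_subr.
have sdG : (P ><| H = G)%g.
  by rewrite sdprodE //; apply: subset_trans sHG (normal_norm nPG).
exists P, H; split; rewrite ?inE //.
  by rewrite (isog_abelian (sdprod_isog sdG)) sub_der1_abelian.
by rewrite /pgroup -(mulKn #|H| (cardG_gt0 P)) (sdprod_card sdG) divgS.
Qed.

Theorem corollary3p5 (F : closedFieldType) (p : nat) (hp : p \in [pchar F]%R)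
    (gT : finGroupType) (G : {group gT})
    (hsoc : ideal_of (group_ring F G) (soc 'Z(group_ring F G)%MS)) :
  exists P H : {group gT},
    [/\ P \in 'Syl_p(G)%g, (P ><| H = G)%g, abelian H & (p^'.-group H)%g].
Proof. exact: sdprod_der1_pgroup (der1_pgroup hp hsoc). Qed.
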